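(* Let $p=p(n)=2^{-o(\sqrt n\log n)}$ and let $t=t(n)$ be a positive integer with $t=o(\sqrt n)$. Then for every $\delta>0$, with probability tending to $1$ as $n\to\infty$, the largest $t$-intersecting family in $\mathcal P(n,p)$ has size between $(\frac12-\delta)2^np$ and $(\frac12+\delta)2^np$.
   Context: A family $\mathcal A\subseteq\mathcal P(n)$ is $t$-intersecting if $|A\cap B|\ge t$ for all $A,B\in\mathcal A$. $\mathcal P(n,p)$ is the random subfamily of $\mathcal P(n)$ including each subset of $[n]$ independently with probability $p$. Logarithms are base 2. *)

(* Defs.v *)
From mathcomp Require Import all_boot all_order all_algebra.
From mathcomp Require Import all_classical all_reals all_analysis.
Set Implicit Arguments.
Unset Strict Implicit.
Unset Printing Implicit Defensive.
Import Order.TTheory GRing.Theory Num.Theory numFieldNormedType.Exports.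
Local Open Scope ring_scope.

(* The ground set [n] is 'I_n, P(n) is {set 'I_n}, and a family of subsets of
   [n] is a {set {set 'I_n}}. *)

Definition log2 (R : realType) (x : R) : R := ln x / ln 2.

(* The sets A and B are not required to be distinct: every member of a
   t-intersecting family has at least t elements. *)
Definition t_intersecting (n t : nat) (F : {set {set 'I_n}}) : bool :=
  [forall A in F, forall B in F, (t <= #|A :&: B|)%N].

(* The empty family is t-intersecting, so the maximum is never vacuous. *)
Definition max_t_intersecting (n t : nat) (F : {set {set 'I_n}}) : nat :=
  \max_(G : {set {set 'I_n}} | (G \subset F) && t_intersecting t G) #|G|.

(* Law of the random family P(n, p): each A : {set 'I_n} is a member with
   probability p, independently of the others. *)
Definition random_family_mass (R : realType) (n : nat) (p : R)
    (F : {set {set 'I_n}}) : R :=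
  \prod_(A : {set 'I_n}) (if A \in F then p else 1 - p).

Definition random_family_prob (R : realType) (n : nat) (p : R)
    (E : pred {set {set 'I_n}}) : R :=
  \sum_(F : {set {set 'I_n}} | E F) random_family_mass p F.

(* Main.v *)
(* Since t >= 1, a t-intersecting family is independent in the disjointness
   graph on P(n), so the upper bound only uses that graph.  For s of order
   sqrt n, join disjoint A, B with |A| + |B| = n - s.  On the layers within
   O(sqrt n) of n/2 this graph is almost regular, of degree
   binom(n/2, s) = 2^Omega(sqrt n log n).  Hence every family of more than
   (1/2 + eps) 2^n sets contains a vertex of that degree, and the container
   algorithm yields containers of size at most (1/2 + eps) 2^n, indexed by
   fingerprints of size o(2^n p).  A union bound over the fingerprints present
   in P(n, p), done inside an exponential moment, gives the upper bound.  For
   the lower bound, the sets of size at least (n + t)/2 form a t-intersecting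
   family of (1/2 - o(1)) 2^n sets, because each layer has at most
   2^n / sqrt n sets and t = o(sqrt n). *)

Require Import Defs.
From mathcomp Require Import all_boot all_order all_algebra.
From mathcomp Require Import all_classical all_reals all_analysis.
(* Re-imported so that their names take precedence over classical_sets. *)
From mathcomp Require Import fintype finset.
From mathcomp Require Import zify ring lra.
Set Implicit Arguments.
Unset Strict Implicit.
Unset Printing Implicit Defensive.
Import Order.TTheory GRing.Theory Num.Theory numFieldNormedType.Exports.
Local Open Scope ring_scope.

(** * Containers and random subsets *)

(** Container algorithm: while the current set is not [small], a vertex with at least [d] neighbours
    in it is queried. Each vertex entering the fingerprint [T] discards its neighbours, whence
    [#|T| * d <= #|V|], and the final set depends on [T] alone. *)
Lemma graph_containers (R : numDomainType) (V : finType) (e : rel V) (d : R)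
    (small : pred {set V}) :
  (forall S, ~~ small S ->
     exists2 v, v \in S & d <= #|[set u in S | e v u]|%:R) ->
  exists2 C : {set V} -> {set V}, (forall T, small (C T)) &
    forall I : {set V}, {in I &, forall u v, ~~ e u v} ->
    exists T : {set V}, [/\ T \subset I, I \subset T :|: C T &
                            #|T|%:R * d <= #|V|%:R].
Proof.
move=> large; suff main k (S : {set V}) : (#|S| <= k)%N ->
  exists2 C : {set V} -> {set V}, (forall T, small (C T)) &
    forall I : {set V}, I \subset S -> {in I &, forall u v, ~~ e u v} ->
    exists T : {set V}, [/\ T \subset I, I \subset T :|: C T &
                            #|T|%:R * d <= #|S|%:R].
  have [C smallC HC] := main _ [set: V] (leqnn _).
  exists C => // I /(HC I (subsetT I)) [T [TI IT Td]].
  by exists T; split=> //; rewrite -cardsT.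
elim: k S => [|k IHk] S leSk; have [smS|/large[v vS degv]] := boolP (small S).
- exists (fun=> S) => // I IS _; exists set0.
  by rewrite sub0set set0U cards0 mul0r.
- by move: leSk; rewrite leqn0 cards_eq0 => /eqP S0; rewrite S0 inE in vS.
- exists (fun=> S) => // I IS _; exists set0.
  by rewrite sub0set set0U cards0 mul0r.
pose S2 := S :\ v :\: [set u in S | e v u].
have leS1 : (#|S :\ v| <= k)%N.
  by move: leSk; rewrite (cardsD1 v) vS.
have leS2 : (#|S2| <= k)%N by rewrite (leq_trans _ leS1)// subset_leq_card// subsetDl.
have [C1 smC1 HC1] := IHk _ leS1; have [C2 smC2 HC2] := IHk _ leS2.
(* If [v \in I], the fingerprint records [v] and the neighbours of [v] are
   discarded; otherwise only [v] is.  Since [v] occurs in neither recursive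
   fingerprint, testing [v \in T] recovers which case applied. *)
exists (fun T : {set V} => if v \in T then C2 (T :\ v) else C1 T) => [T|I IS indI].
  by case: ifP.
have [vI|vI] := boolP (v \in I); last first.
  have [|T [TI IT Td]] := HC1 I _ indI.
    by apply/subsetP=> u uI; rewrite !inE (subsetP IS)// andbT;
       apply: contraNneq vI => <-.
  exists T; rewrite (negbTE (contra (subsetP TI v) vI)); split=> //.
  by rewrite (le_trans Td)// ler_nat subset_leq_card// subsetDl.
have [||T [TI IT Td]] := HC2 (I :\ v).
- apply/subsetP=> u; rewrite !inE => /andP[-> uI].
  by rewrite (subsetP IS)//= andbT; apply: indI.
- by move=> a b; rewrite !inE => /andP[_ aI] /andP[_ bI]; apply: indI.
have vT : v \notin T by apply/negP => /(subsetP TI); rewrite !inE eqxx.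
exists (v |: T); rewrite setU11 setU1K//; split.
- by rewrite subUset sub1set vI (subset_trans TI)// subsetDl.
- apply/subsetP=> u uI; rewrite !inE; case: eqVneq => //= uv.
  by move: (subsetP IT u); rewrite !inE uv uI => /(_ isT).
(* The neighbours of [v] in [S] and the set [S2] are disjoint parts of [S], so the discarded
   neighbours pay for the new element of [T]. *)
rewrite cardsU1 vT natrD mulrDl mul1r (le_trans (lerD degv Td))//.
rewrite -natrD ler_nat -cardsUI -[leqRHS]addn0; apply: leq_add.
  apply: subset_leq_card; rewrite subUset; apply/andP; split.
    by apply/subsetP=> u; rewrite inE => /andP[].
  by rewrite /S2 setDDl subsetDl.
rewrite leqn0 cards_eq0; apply/eqP/setP=> u; rewrite !inE.
by case: (u \in S) => //=; case: (e v u); rewrite ?andbF.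
Qed.

(** By independence the sum factors over [V]: a factor [p] on [T], [1 + p * (x - 1)] on [C], and 1
    elsewhere. *)
Lemma random_set_mgf (R : comNzRingType) (V : finType) (p x : R) (T C : {set V}) :
  [disjoint T & C] ->
  \sum_(F : {set V} | T \subset F)
     (\prod_v (if v \in F then p else 1 - p)) * x ^+ #|F :&: C|
  = p ^+ #|T| * (1 + p * (x - 1)) ^+ #|C|.
Proof.
move=> dTC.
(* [f v] and [g v] are the weights of [v] inside and outside [F]; as [g] vanishes on [T], expanding
   the product of the [f v + g v] leaves only the [F] containing [T]. *)
pose f v := p * (if v \in C then x else 1).
pose g v := if v \in T then 0 else 1 - p.
have fg v : f v + g v =
    (if v \in T then p else 1) * (if v \in C then 1 + p * (x - 1) else 1).
  rewrite /f /g; have [vT|vT] := boolP (v \in T).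
    by rewrite (disjointFr dTC vT) addr0 !mulr1.
  by case: (v \in C); rewrite mul1r; ring.
transitivity (\prod_v (f v + g v)); last first.
  under eq_bigr do rewrite fg.
  rewrite big_split/= -!big_mkcond/=.
  by rewrite !prodr_const.
rewrite bigA_distr [RHS](bigID (fun F : {set V} => T \subset F))/=.
rewrite [X in _ = _ + X]big1 ?addr0.
  apply: eq_big => //= F TF.
  have -> : x ^+ #|F :&: C| = \prod_v (if v \in F :&: C then x else 1).
    by rewrite -big_mkcond/= prodr_const.
  rewrite -big_split; apply: eq_bigr => v _ /=; rewrite inE /f /g.
  case: ifP => //= vF; rewrite mulr1.
  by rewrite (contraFF (subsetP TF v) vF).
move=> F /subsetPn[v vT vF]; rewrite (bigD1 v)//= (negbTE vF) /g vT.
by rewrite mul0r.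
Qed.

Lemma sum_pow_card (R : comNzRingType) (V : finType) (x : R) :
  \sum_(T : {set V}) x ^+ #|T| = (1 + x) ^+ #|V|.
Proof.
have -> : (1 + x) ^+ #|V| = \prod_(v : V) (x + 1).
  by rewrite prodr_const addrC.
rewrite bigA_distr; apply: eq_bigr => T _.
by rewrite -big_mkcond/= prodr_const.
Qed.

(** * Layers of the Boolean lattice *)

Lemma card_set_ord (n : nat) : #|{: {set 'I_n}}| = (2 ^ n)%N.
Proof. by rewrite -cardsT -powersetT card_powerset cardsT card_ord. Qed.

Lemma sum_by_card (M : nmodType) (n : nat) (g : nat -> M) :
  \sum_(A : {set 'I_n}) g #|A| = \sum_(k < n.+1) g k *+ 'C(n, k).
Proof.
rewrite (partition_big (fun A : {set 'I_n} => inord #|A| : 'I_n.+1) xpredT)//=.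
apply: eq_bigr => k _.
have eqk (A : {set 'I_n}) : (inord #|A| == k :> 'I_n.+1) = (#|A| == k :> nat).
  by rewrite -val_eqE /= inordK// ltnS -[X in (_ <= X)%N](card_ord n) max_card.
under eq_bigl do rewrite eqk.
rewrite (eq_bigr (fun=> g k)) => [|A /eqP->//].
rewrite sumr_const; congr (_ *+ _).
by have := card_draws 'I_n k; rewrite card_ord => <-; apply: eq_card => A; rewrite !inE.
Qed.

Lemma sum_by_cardS (M : nmodType) (n : nat) (g : nat -> M) :
  \sum_(A : {set 'I_n.+1}) g #|A|
  = \sum_(A : {set 'I_n}) (g #|A| + g #|A|.+1).
Proof.
rewrite big_split/= (sum_by_card n g) (sum_by_card n (g \o succn)) sum_by_card.
rewrite big_ord_recl bin0 [X in _ = X + _]big_ord_recl bin0 -addrA; congr (_ + _).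
rewrite (eq_bigr (fun i : 'I_n.+1 => g i.+1 *+ 'C(n, i.+1) + g i.+1 *+ 'C(n, i))).
  rewrite big_split/= big_ord_recr/= [in X in X + _ = _](bin_small (leqnn _)).
  by rewrite mulr0n addr0.
by move=> i _; rewrite /= /bump/= add1n binS mulrnDr.
Qed.

(** Divided by [2 ^+ n], this is the variance of a sum of [n] independent signs. *)
Lemma sum_sqr_dev (R : comNzRingType) (n : nat) :
  \sum_(A : {set 'I_n}) (2 * #|A|%:R - n%:R) ^+ 2 = n%:R * 2 ^+ n :> R.
Proof.
elim: n => [|n IHn].
  rewrite (sum_by_card 0 (fun k => (2 * k%:R - 0%:R) ^+ 2)) big_ord_recl big_ord0.
  by rewrite /= !(mulr0, subr0, expr0n, mul0r, mul0rn, addr0).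
rewrite (sum_by_cardS n (fun k => (2 * k%:R - n.+1%:R) ^+ 2)).
(* A deviation x splits into x - 1 and x + 1, whose squares add up to 2x^2 + 2. *)
rewrite (eq_bigr (fun A : {set 'I_n} => 2 * (2 * #|A|%:R - n%:R) ^+ 2 + 2)).
  rewrite big_split/= -mulr_sumr IHn sumr_const card_set_ord.
  by rewrite -[2 *+ _]mulr_natr natrX -(natr1 n) exprS; ring.
by move=> A _; ring.
Qed.

Local Close Scope ring_scope.

(** * Binomial estimates and the sizes of the layers *)

Lemma leq_bin_mid (n k : nat) : 'C(n, k) <= 'C(n, n./2).
Proof.
have low j : j <= n./2 -> 'C(n, j) <= 'C(n, n./2).
  move=> lej; rewrite -(subKn lej); move: (n./2 - j) (leq_subr j n./2) => i.
  elim: i => [|i IHi] lei; first by rewrite subn0.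
  rewrite (leq_trans _ (IHi (ltnW lei)))//.
  set m := n./2 - i.+1; have -> : n./2 - i = m.+1 by lia.
  rewrite -(leq_pmul2l (ltn0Sn m)) mul_bin_left leq_mul2r; apply/orP; right.
  by rewrite /m; lia.
have [/low//|lt_k] := leqP k n./2; have [lekn|/bin_small->//] := leqP k n.
by rewrite -bin_sub//; apply: low; lia.
Qed.

(** Squared form of C(2m,m) <= 4^m / sqrt(2m+1); the induction step reduces to (2m+1)(2m+3) <=
    (2m+2)^2. *)
Lemma bin_double_bound (m : nat) : 'C(m.*2, m) ^ 2 * m.*2.+1 <= 4 ^ m.*2.
Proof.
elim: m => // m IHm.
have E : m.+1 * 'C(m.+1.*2, m.+1) = 2 * (m.*2.+1 * 'C(m.*2, m)).
  have /= e1 := mul_bin_diag m.+1.*2 m; have /= e2 := mul_bin_down m.*2.+1 m.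
  rewrite -e1 e2; have -> : m.*2.+1 - m = m.+1 by lia.
  by rewrite doubleS -mul2n; lia.
have E2 : m.+1 ^ 2 * 'C(m.+1.*2, m.+1) ^ 2 = 4 * m.*2.+1 * ('C(m.*2, m) ^ 2 * m.*2.+1).
  by rewrite -expnMn E; ring.
rewrite -(leq_pmul2l (_ : 0 < m.+1 ^ 2))// mulnA E2.
have -> : 4 ^ m.+1.*2 = 16 * 4 ^ m.*2 by rewrite doubleS !expnS; ring.
apply: (@leq_trans (4 * m.*2.+1 * 4 ^ m.*2 * (m.+1.*2).+1)).
  by rewrite leq_mul2r leq_mul2l IHm !orbT.
rewrite [leqRHS]mulnA -mulnA [_ * m.+1.*2.+1]mulnC mulnA leq_mul2r; apply/orP; right.
by rewrite -!muln2; nia.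
Qed.

Lemma bin_mid_bound (n : nat) : 'C(n, n./2) ^ 2 * n.+1 <= 4 ^ n.
Proof.
have := odd_double_half n; case: (odd n) => /= <-; last first.
  by rewrite !add0n doubleK bin_double_bound.
set m := n./2; have -> : (1 + m.*2)./2 = m by lia.
(* The odd case follows from the next even one, whose central coefficient is exactly twice as
   large. *)
have E : 'C(m.+1.*2, m.+1) = 2 * 'C(m.*2.+1, m).
  apply/eqP; rewrite -(eqn_pmul2l (ltn0Sn m)) -mul_bin_diag doubleS /=.
  by apply/eqP; rewrite -!mul2n; ring.
have := bin_double_bound m.+1; rewrite E add1n expnMn.
have -> : 4 ^ m.+1.*2 = 4 * 4 ^ m.*2.+1 by rewrite doubleS !expnS; ring.
rewrite -mulnA leq_pmul2l// => h; apply: leq_trans h.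
by rewrite leq_mul2l; apply/orP; right; lia.
Qed.

Lemma card_near_half (n t : nat) :
  #|[set A : {set 'I_n} | (n < #|A|.*2 + t) && (#|A|.*2 < n + t)]|
    <= t * 'C(n, n./2).
Proof.
(* [a] is the least k with n < 2k + t (0 when [t] exceeds [n], by truncation); only the [t] sizes
   from [a] on can also satisfy 2k < n + t. *)
pose a := uphalf (n.+1 - t).
have sub : [set A : {set 'I_n} | (n < #|A|.*2 + t) && (#|A|.*2 < n + t)]
    \subset \bigcup_(j < t) [set A : {set 'I_n} | #|A| == a + j].
  apply/subsetP => A; rewrite inE => /andP[lo hi].
  have lta : a <= #|A| by rewrite /a; lia.
  have ltj : #|A| - a < t by rewrite /a in lta *; lia.
  by apply/bigcupP; exists (Ordinal ltj) => //; rewrite inE /= subnKC.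
apply: leq_trans (subset_leq_card sub) _.
have -> : (t * 'C(n, n./2) = \sum_(j < t) 'C(n, n./2))%N by rewrite sum_nat_const card_ord.
elim/big_rec2: _ => [|j m B _ leBm]; first by rewrite cards0.
apply: leq_trans (leq_add _ leBm); first exact: leq_of_leqif (leq_card_setU _ _).
by have := card_draws 'I_n (a + j); rewrite card_ord => ->; apply: leq_bin_mid.
Qed.

(** Complementation carries the sets with n + t <= 2|A| onto those with 2|A| + t <= n; all others
    lie in the layers near the middle. *)
Lemma card_upper_layers (n t : nat) :
  2 ^ n <= 2 * #|[set A : {set 'I_n} | n + t <= #|A|.*2]| + t * 'C(n, n./2).
Proof.
set U := [set A | _]; pose L := [set ~: A | A in U].
pose M := [set A : {set 'I_n} | (n < #|A|.*2 + t) && (#|A|.*2 < n + t)].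
have cardL : #|L| = #|U| by rewrite card_imset//; apply: setC_inj.
rewrite -[X in 2 ^ X](card_ord n) -cardsT -card_powerset powersetT.
have sub : [set: {set 'I_n}] \subset M :|: (U :|: L).
  apply/subsetP => A _; rewrite !inE.
  have [hi|hi] := leqP (n + t) #|A|.*2; first by rewrite orbT.
  rewrite andbT /=.
  have [//|lo] := ltnP n (#|A|.*2 + t); apply/imsetP; exists (~: A).
    by rewrite inE cardsCs setCK card_ord; lia.
  by rewrite setCK.
apply: leq_trans (subset_leq_card sub) _.
apply: leq_trans (leq_of_leqif (leq_card_setU _ _)) _.
rewrite addnC leq_add ?card_near_half//.
apply: leq_trans (leq_of_leqif (leq_card_setU _ _)) _.
by rewrite cardL mul2n addnn.
Qed.

Lemma upper_layers_t_intersecting (n t : nat) (A B : {set 'I_n}) :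
  n + t <= #|A|.*2 -> n + t <= #|B|.*2 -> t <= #|A :&: B|.
Proof.
have := cardsUI A B; have := max_card (A :|: B); rewrite card_ord.
by lia.
Qed.

Lemma bin_lower_bound (m s : nat) : (m - s) ^ s <= 'C(m, s) * s ^ s.
Proof.
have fact_le k : k`! <= k ^ k.
  elim: k => // k IHk; rewrite factS expnS leq_mul2l /=.
  by rewrite (leq_trans IHk)//; case: (k) => // j; rewrite leq_exp2r.
have ffact_ge k j : (k - j) ^ j <= k ^_ j.
  elim: j => // j IHj; rewrite ffactnSr expnSr leq_mul ?leq_sub2l//.
  by rewrite (leq_trans _ IHj)//; case: j {IHj} => // j; rewrite leq_exp2r//; lia.
by rewrite (leq_trans (ffact_ge m s))// -bin_ffact leq_mul2l fact_le orbT.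
Qed.

Local Open Scope ring_scope.

(** * Supersaturation *)

(** Division-free form of (1 - js/m) C(m+j,s) <= C(m,s): by Pascal's rule, each of the [j] steps
    costs at most a fraction s/m of the largest coefficient. *)
Lemma bin_shift_bound (m j s : nat) :
  (m * 'C(m + j, s) <= m * 'C(m, s) + j * s * 'C(m + j, s))%N.
Proof.
case: s => [|s]; first by rewrite !bin0; lia.
elim: j => [|j IHj]; first by rewrite addn0 leq_addr.
have h : (m * 'C(m + j, s) <= s.+1 * 'C(m + j.+1, s.+1))%N.
  by rewrite addnS -mul_bin_diag leq_mul2r; lia.
have h2 : (j * s.+1 * 'C(m + j, s.+1) <= j * s.+1 * 'C(m + j.+1, s.+1))%N.
  by rewrite leq_mul2l leq_bin2l ?orbT//; lia.
move: h h2; rewrite addnS binS; set a := 'C(_, s); set b := 'C(_, s.+1).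
by move=> h h2; move: IHj; rewrite -/b; lia.
Qed.

Definition middle (n w : nat) (A : {set 'I_n}) : bool :=
  (n./2 <= #|A| + w)%N && (#|A| <= n./2 + w)%N.

(** Chebyshev's inequality: a set off the middle layers deviates by at least 2w in [sum_sqr_dev]. *)
Lemma card_not_middle (n w : nat) :
  (4 * w ^ 2 * #|[set A : {set 'I_n} | ~~ middle w A]| <= n * 2 ^ n)%N.
Proof.
rewrite -(@ler_nat int) [leRHS]natrM [(2 ^ n)%:R]natrX -sum_sqr_dev.
rewrite mulnC natrM mulr_natl -sumr_const.
rewrite [leRHS](bigID (fun A : {set 'I_n} => ~~ middle w A))/=.
rewrite (eq_bigl (fun A : {set 'I_n} => ~~ middle w A)) => [|A]; last by rewrite inE.
rewrite -[leLHS]addr0; apply: lerD; last by apply: sumr_ge0 => A _; exact: sqr_ge0.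
apply: ler_sum => A; rewrite /middle => mA.
have w0 : 0 <= w%:R :> int by [].
have [h|h] : 2 * w%:R <= n%:R - 2 * #|A|%:R :> int \/
    2 * w%:R <= 2 * #|A|%:R - n%:R :> int by rewrite !natz; lia.
- by rewrite natrM natrX; nra.
- by rewrite natrM natrX; nra.
Qed.

(* Degrees are explicit binomials here ([card_gapped_disjoint]), almost constant
   over the middle layers, whereas disjointness alone is far from regular. *)
Definition gapped_disjoint (n s : nat) : rel {set 'I_n} :=
  fun A B => [disjoint A & B] && (#|A| + #|B| + s == n)%N.

Lemma gapped_disjointC (n s : nat) : symmetric (@gapped_disjoint n s).
Proof.
by move=> A B; rewrite /gapped_disjoint disjoint_sym (addnC #|A|).
Qed.

(** Such a [B] is the complement of [A] with [s] points removed. *)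
Lemma card_gapped_disjoint (n s : nat) (A : {set 'I_n}) :
  #|[set B | gapped_disjoint s A B]| = 'C(n - #|A|, s).
Proof.
have cA : #|~: A| = (n - #|A|)%N by rewrite cardsCs setCK card_ord.
have leA : (#|A| <= n)%N by rewrite -[leqRHS]card_ord max_card.
have [les|lts] := leqP s (n - #|A|); last first.
  rewrite bin_small//; apply/eqP; rewrite cards_eq0; apply/eqP/setP => B.
  by rewrite !inE /gapped_disjoint; apply/negbTE; rewrite negb_and; lia.
rewrite -bin_sub// -cA -cards_draws; apply: eq_card => B.
rewrite !inE /gapped_disjoint disjoint_sym disjoints_subset cA.
by congr (_ && _); apply/eqP/eqP; lia.
Qed.

(** Double counting of gapped-disjoint pairs from the middle part [F'] of [F]. If all degrees inside
    [F] were small, almost all these pairs would end outside [F]; near-regularity would then make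
    [~: F] almost as large as [F'], which the size of [F] forbids. *)
Lemma supersaturation (R : realFieldType) (n w s : nat) (eps : R)
    (F : {set {set 'I_n}}) :
  0 < eps -> eps <= 2^-1 -> (s + w <= n./2)%N ->
  #|[set A : {set 'I_n} | ~~ middle w A]|%:R <= eps / 2 * 2 ^+ n ->
  (1 - eps) * 'C(n./2 + w + s, s)%:R <= 'C(n./2 - w, s)%:R :> R ->
  (2^-1 + eps) * 2 ^+ n < #|F|%:R ->
  exists2 A, A \in F &
    eps / 4 * 'C(n./2 + w + s, s)%:R <= #|[set B in F | [disjoint A & B]]|%:R.
Proof.
move=> e0 e1 sw fewnm ratio largeF; set D := 'C(_ + _, s) in ratio *.
have D0 : 0 < D%:R :> R by rewrite ltr0n bin_gt0; lia.
pose d (A : {set 'I_n}) := #|[set B in F | [disjoint A & B]]|.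
case: (pselect (exists2 A, A \in F & eps / 4 * D%:R <= (d A)%:R)) => // noA.
pose F' := [set A in F | middle w A].
pose E := @gapped_disjoint n s.
have few (A : {set 'I_n}) : A \in F -> (d A)%:R <= eps / 4 * D%:R.
  by move=> AF; rewrite leNgt; apply/negP => /ltW h; apply: noA; exists A.
have degE (A : {set 'I_n}) : \sum_(B | E A B) 1 = 'C(n - #|A|, s).
  by rewrite -card_gapped_disjoint sum1dep_card.
have double : (#|F'| * 'C(n./2 - w, s) <= \sum_(A in F') d A + #|~: F| * D)%N.
  rewrite -!sum_nat_const.
  apply: (@leq_trans (\sum_(A in F') \sum_(B | E A B) 1)%N).
    apply: leq_sum => A; rewrite inE degE => /andP[_ /andP[_ hi]].
    by apply: leq_bin2l; lia.
  rewrite (eq_bigr (fun A => \sum_(B | E A B && (B \in F)) 1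
                  + \sum_(B | E A B && (B \notin F)) 1)%N); last first.
    by move=> A _; rewrite (bigID (mem F)).
  rewrite big_split /= leq_add//.
    apply: leq_sum => A _; rewrite sum1dep_card; apply: subset_leq_card.
    by apply/subsetP => B; rewrite !inE => /andP[/andP[-> _] ->].
  rewrite (exchange_big_dep (mem (~: F))) /= => [|A B _ /andP[_]]; last by rewrite inE.
  apply: leq_sum => B BF.
  (* One neighbour [A] in the middle layers suffices to bound the degree of [B], since n - |B| = |A|
     + s. *)
  have [A AB|noE] := pickP (fun A => (A \in F') && E A B); last first.
    by rewrite big_pred0// => A; rewrite andbA noE.
  apply: (@leq_trans (\sum_(A | E B A) 1)%N).
    rewrite !sum1dep_card; apply: subset_leq_card; apply/subsetP => A'.
    by rewrite !inE /E (@gapped_disjointC _ _ B) => /andP[_ /andP[]].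
  rewrite degE; apply: leq_bin2l; move: AB; rewrite inE => /andP[/andP[_ /andP[_ hi]]].
  by move=> /andP[_ /eqP]; lia.
have dF' : (\sum_(A in F') d A)%:R <= #|F'|%:R * (eps / 4 * D%:R).
  rewrite natr_sum mulr_natl -sumr_const; apply: ler_sum => A.
  by rewrite inE => /andP[/few].
have F'F : #|F|%:R <= #|F'|%:R + eps / 2 * 2 ^+ n.
  apply: le_trans (lerD (lexx _) fewnm); rewrite -natrD ler_nat.
  apply: leq_trans (leq_of_leqif (leq_card_setU _ _)); apply: subset_leq_card.
  by apply/subsetP => A AF; rewrite !inE AF /=; case: middle.
have FC : #|F|%:R + #|~: F|%:R = 2 ^+ n :> R.
  by rewrite -natrD cardsC card_set_ord natrX.
have {}double : #|F'|%:R * ((1 - eps) * D%:R) <= #|F'|%:R * (eps / 4 * D%:R) + #|~: F|%:R * D%:R.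
  rewrite -(ler_nat R) natrD !natrM in double.
  apply: le_trans (le_trans _ double) _; first by rewrite ler_wpM2l.
  by rewrite lerD2r.
have N0 : 0 < 2 ^+ n :> R by rewrite exprn_gt0.
have {}double : #|F'|%:R * (1 - 5 / 4 * eps) <= #|~: F|%:R.
  rewrite -(ler_pM2r D0); move: double; lra.
have h1 : (2^-1 + eps / 2) * 2 ^+ n <= #|F'|%:R by lra.
have h2 : #|~: F|%:R < (2^-1 - eps) * 2 ^+ n by lra.
have h3 : (2^-1 + eps / 2) * 2 ^+ n * (1 - 5 / 4 * eps) < (2^-1 - eps) * 2 ^+ n.
  by apply: le_lt_trans h2; apply: le_trans double; rewrite ler_wpM2r//; lra.
exfalso; move: h3; apply/negP; rewrite -leNgt mulrAC ler_pM2r//; nra.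
Qed.

(** * Exponential tail bounds *)

Lemma random_family_mass_ge0 (R : realType) (n : nat) (p : R) (F : {set {set 'I_n}}) :
  0 <= p <= 1 -> 0 <= random_family_mass p F.
Proof.
by case/andP=> p0 p1; apply: prodr_ge0 => A _; case: ifP => // _; rewrite subr_ge0.
Qed.

Lemma random_family_mass_sum (R : realType) (n : nat) (p : R) :
  \sum_(F : {set {set 'I_n}}) random_family_mass p F = 1.
Proof.
rewrite /random_family_mass.
have := @bigA_distr R 0 1 _ _ {set 'I_n} (fun=> p) (fun=> 1 - p).
move=> /= <-; rewrite big1// => A _; exact: subrKC.
Qed.

(** Markov's inequality, with the threshold absorbed into [X]. *)
Lemma random_family_prob_le_sum (R : realType) (n : nat) (p : R)
    (E : pred {set {set 'I_n}}) (X : {set {set 'I_n}} -> R) :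
  0 <= p <= 1 -> (forall F, 0 <= X F) -> (forall F, E F -> 1 <= X F) ->
  random_family_prob p E <= \sum_F random_family_mass p F * X F.
Proof.
move=> p01 X0 X1; rewrite [leRHS](bigID E)/= -[leLHS]addr0; apply: lerD.
  by apply: ler_sum => F /X1; apply: ler_peMr; exact: random_family_mass_ge0.
by apply: sumr_ge0 => F _; rewrite mulr_ge0// random_family_mass_ge0.
Qed.

Lemma random_family_prob_ge (R : realType) (n : nat) (p : R)
    (E E1 E2 : pred {set {set 'I_n}}) :
  0 <= p <= 1 -> (forall F, [|| E F, E1 F | E2 F]) ->
  1 - random_family_prob p E1 - random_family_prob p E2 <= random_family_prob p E.
Proof.
move=> p01 cover; rewrite !lerBlDr -(@random_family_mass_sum R n p).
rewrite /random_family_prob (big_mkcond E) (big_mkcond E1) (big_mkcond E2) -!big_split/=.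
apply: ler_sum => F _; have := cover F; have := random_family_mass_ge0 F p01.
by case: (E F); case: (E1 F); case: (E2 F) => //=; lra.
Qed.

Lemma random_family_prob_le1 (R : realType) (n : nat) (p : R) (E : pred {set {set 'I_n}}) :
  0 <= p <= 1 -> random_family_prob p E <= 1.
Proof.
move=> p01; rewrite -(@random_family_mass_sum R n p) [leRHS](bigID E)/= lerDl.
by apply: sumr_ge0 => F _; apply: random_family_mass_ge0.
Qed.

Lemma exp1D_le_expR (R : realType) (x : R) (k : nat) :
  0 <= 1 + x -> (1 + x) ^+ k <= expR (k%:R * x).
Proof. by move=> x0; rewrite expRM_natl lerXn2r ?nnegrE ?expR_ge0 ?expR_ge1Dx. Qed.

(** Chernoff's method: Markov's inequality for an exponential moment, given by [random_set_mgf] with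
    empty [T]. *)
Lemma random_family_lower_tail (R : realType) (n : nat) (p c a : R)
    (K : {set {set 'I_n}}) :
  0 <= p <= 1 -> 0 <= c ->
  random_family_prob p (fun F => #|F :&: K|%:R < a)
    <= expR (c * a - p * (1 - expR (- c)) * #|K|%:R).
Proof.
move=> p01 c0; have /andP[p0 p1] := p01.
pose X (F : {set {set 'I_n}}) := expR (c * (a - #|F :&: K|%:R)).
apply: le_trans (random_family_prob_le_sum (X := X) p01 _ _) _.
- by move=> F; exact: expR_ge0.
- move=> F ltF; rewrite -[leLHS]expR0 ler_expR mulr_ge0// subr_ge0 ltW//.
have XE F : X F = expR (c * a) * expR (- c) ^+ #|F :&: K|.
  by rewrite -expRM_natl -expRD; congr expR; ring.
under eq_bigr do rewrite XE mulrCA.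
rewrite -mulr_sumr expRD ler_pM2l ?expR_gt0//.
have := @random_set_mgf R {set 'I_n} p (expR (- c)) set0 K.
rewrite disjoint_sym disjoints_subset setC0 subsetT => /(_ isT).
under eq_bigl do rewrite sub0set.
rewrite /random_family_mass => ->; rewrite cards0 expr0 mul1r.
have := expR_ge0 (- c); have : expR (- c) <= 1 by rewrite expR_le1; lra.
move=> e1 e0; apply: le_trans (exp1D_le_expR _ _) _; first by nra.
by rewrite ler_expR; nra.
Qed.

Lemma max_t_intersecting_witness (n t : nat) (F : {set {set 'I_n}}) :
  exists G : {set {set 'I_n}}, [/\ G \subset F, t_intersecting t G &
    max_t_intersecting t F = #|G|].
Proof.
pose P (G : {set {set 'I_n}}) := (G \subset F) && t_intersecting t G.
have P0 : P set0 by rewrite /P sub0set; apply/'forall_implyP => A; rewrite inE.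
have [|G /andP[GF tG] maxG] := @eq_bigmax_cond _ P (fun G => #|G|).
  by apply/card_gt0P; exists set0.
by exists G.
Qed.

(** A large t-intersecting subfamily of [F] forces, for some fingerprint [T] inside [F], many
    members of [F] in [C T]. Here [gam] bounds [#|T|] relative to the mean [2 ^+ n * p], [L]
    penalises large fingerprints, and [c] is the Chernoff parameter. *)
Lemma random_family_upper_tail (R : realType) (n t : nat)
    (p c L eps gam delta d : R) :
  0 <= p <= 1 -> (0 < t)%N -> 0 <= c -> 0 <= L -> 0 <= gam ->
  (forall S : {set {set 'I_n}}, (2^-1 + eps) * 2 ^+ n < #|S|%:R ->
    exists2 A, A \in S & d <= #|[set B in S | [disjoint A & B]]|%:R) ->
  1 <= gam * p * d ->
  random_family_prob p
    (fun F : {set {set 'I_n}} =>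
       (2^-1 + delta) * 2 ^+ n * p < (max_t_intersecting t F)%:R)
  <= expR (2 ^+ n * p *
       ((L + c) * gam - c * (2^-1 + delta) + (expR c - 1) * (2^-1 + eps)
        + expR (- L))).
Proof.
move=> p01 t0 c0 L0 gam0 sat gpd; have /andP[p0 p1] := p01.
set mu := 2 ^+ n * p.
pose small (S : {set {set 'I_n}}) := #|S|%:R <= (2^-1 + eps) * 2 ^+ n.
have [C smallC contC] : exists2 C : {set {set 'I_n}} -> {set {set 'I_n}},
    (forall T, small (C T)) &
    forall I : {set {set 'I_n}}, {in I &, forall A B : {set 'I_n}, ~~ [disjoint A & B]} ->
    exists T : {set {set 'I_n}}, [/\ T \subset I, I \subset T :|: C T &
                            #|T|%:R * d <= #|{: {set 'I_n}}|%:R].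
  apply: (graph_containers (e := fun A B : {set 'I_n} => [disjoint A & B])) => S; rewrite /small -ltNge; exact: sat.
(* The factor in [L] replaces the constraint [#|T| <= gam * mu] on the
   fingerprints, so that the sum over all [T] becomes a binomial expansion. *)
pose Y (T F : {set {set 'I_n}}) := expR (L * (gam * mu - #|T|%:R)) *
  expR (c * (#|F :&: (C T :\: T)|%:R + gam * mu - (2^-1 + delta) * mu)).
pose X (F : {set {set 'I_n}}) := \sum_(T : {set {set 'I_n}} | T \subset F) Y T F.
have Y0 (T F : {set {set 'I_n}}) : 0 <= Y T F by rewrite mulr_ge0// expR_ge0.
apply: le_trans (random_family_prob_le_sum (X := X) p01 _ _) _.
- by move=> F; apply: sumr_ge0 => T _.
- move=> F; have [G [GF tG ->]] := max_t_intersecting_witness t F => largeG.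
  have [|T [TG GT Td]] := contC G.
    move=> A B AG BG; rewrite -setI_eq0 -card_gt0; apply: leq_trans t0 _.
    by move/forall_inP: tG => /(_ A AG) /forall_inP /(_ B BG).
  have Tsmall : #|T|%:R <= gam * mu.
    rewrite card_set_ord natrX in Td.
    apply: (@le_trans _ _ (gam * p * (#|T|%:R * d))).
      by rewrite mulrCA ler_peMr.
    by rewrite -mulrA ler_wpM2l// /mu (mulrC (2 ^+ n)) ler_wpM2l.
  have TF : T \subset F by exact: subset_trans GF.
  (* The term of the actual fingerprint is already at least 1, both of its exponents being
     nonnegative. *)
  rewrite /X (bigD1 T)//= -[leLHS]addr0 lerD ?sumr_ge0//.
  rewrite /Y -expRD -[leLHS]expR0 ler_expR addr_ge0 ?mulr_ge0//.
    by rewrite subr_ge0.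
  have : #|G|%:R <= #|T|%:R + #|F :&: (C T :\: T)|%:R :> R.
    rewrite -natrD ler_nat; apply: leq_trans (leq_of_leqif (leq_card_setU _ _)).
    apply: subset_leq_card; apply/subsetP => A AG; move: (subsetP GT A AG).
    by rewrite !inE (subsetP GF)//; case: (A \in T).
  move: largeG; rewrite -mulrA -/mu; lra.
pose r := expR ((gam * mu) * L + c * (gam * mu - (2^-1 + delta) * mu)) 
   * expR (p * (expR c - 1) * ((2^-1 + eps) * 2 ^+ n)).
apply: (@le_trans _ _ (\sum_(T : {set {set 'I_n}}) r * (p * expR (- L)) ^+ #|T|)).
  rewrite /X; under eq_bigr do rewrite mulr_sumr.
  rewrite (exchange_big_dep xpredT)//=; apply: ler_sum => T _.
  have -> : \sum_(F : {set {set 'I_n}} | T \subset F) random_family_mass p F * Y T F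
    = expR ((gam * mu) * L + c * (gam * mu - (2^-1 + delta) * mu)) * expR (- L) ^+ #|T|
      * \sum_(F : {set {set 'I_n}} | T \subset F)
           random_family_mass p F * expR c ^+ #|F :&: (C T :\: T)|.
    rewrite mulr_sumr; apply: eq_bigr => F _.
    rewrite [RHS]mulrCA; congr (_ * _); rewrite /Y -!expRM_natl -!expRD; congr expR; ring.
  (* Removing [T] from its container makes the event that [T] lies in [F] independent of the count
     in the rest. *)
  rewrite random_set_mgf; last by rewrite disjoints_subset setCD subsetUr.
  rewrite exprMn /r.
  have ec : 0 <= expR c - 1 by rewrite subr_ge0 -expR0 ler_expR.
  have le2 : (1 + p * (expR c - 1)) ^+ #|C T :\: T|
      <= expR (p * (expR c - 1) * ((2^-1 + eps) * 2 ^+ n)).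
    apply: le_trans (exp1D_le_expR _ _) _; first by rewrite addr_ge0// mulr_ge0.
    rewrite ler_expR mulrC ler_wpM2l ?mulr_ge0//.
    by apply: le_trans (smallC T); rewrite ler_nat subset_leq_card// subsetDl.
  have rearrange (a b k z e : R) : 0 <= a -> 0 <= b -> 0 <= k -> z <= e ->
      a * b * (k * z) <= a * e * (k * b).
    move=> a0 b0 k0 ze; rewrite -!mulrA ler_wpM2l// mulrCA [leRHS]mulrCA ler_wpM2l//.
    by rewrite mulrC ler_wpM2r.
  by apply: rearrange; rewrite ?expR_ge0 ?exprn_ge0 ?expR_ge0.
rewrite -mulr_sumr sum_pow_card card_set_ord.
apply: (@le_trans _ _ (r * expR ((2 ^ n)%:R * (p * expR (- L))))).
  rewrite ler_wpM2l ?mulr_ge0 ?expR_ge0// exp1D_le_expR//.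
  by rewrite addr_ge0// mulr_ge0// expR_ge0.
rewrite /r -!expRD ler_expR natrX /mu le_eqVlt; apply/orP; left; apply/eqP; ring.
Qed.

(** * Concentration with constants depending on [delta] only *)

Lemma upper_tail_constants (R : realType) (delta : R) :
  0 < delta -> delta <= 4^-1 ->
  exists c L gam kappa : R, [/\ 0 <= c, 0 <= L, 0 < gam, 0 < kappa &
    (L + c) * gam - c * (2^-1 + delta) + (expR c - 1) * (2^-1 + delta / 4)
      + expR (- L) <= - kappa].
Proof.
(* The main terms give at most -c delta/2 = -delta^2/8; [L] and then [gam] are chosen to make each
   of the two error terms at most delta^2/32. *)
move=> d0 d1; pose c := delta / 4; pose L := 32 / delta ^+ 2.
have L0 : 0 < L by rewrite divr_gt0// exprn_gt0.
exists c, L, (delta ^+ 2 / 32 / (L + 1)), (delta ^+ 2 / 16).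
have c0 : 0 < c by rewrite /c; lra.
split; [exact: ltW|exact: ltW| | |].
- by rewrite !divr_gt0 ?exprn_gt0// addr_gt0.
- by rewrite divr_gt0 ?exprn_gt0.
have h1 : expR (- L) <= delta ^+ 2 / 32.
  rewrite expRN -[leRHS]invrK lef_pV2 ?posrE ?invr_gt0 ?expR_gt0 ?divr_gt0 ?exprn_gt0//.
  by rewrite invf_div -/L; apply: le_trans (expR_ge1Dx L); rewrite lerDr.
have h2 : (L + c) * (delta ^+ 2 / 32 / (L + 1)) <= delta ^+ 2 / 32.
  rewrite mulrA ler_pdivrMr ?addr_gt0// mulrC ler_wpM2l ?divr_ge0 ?exprn_ge0 ?ltW//.
  by rewrite /c; lra.
have h3 : expR c * (1 - c) <= 1.
  have := expR_ge1Dx (- c); rewrite expRN.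
  by rewrite -ler_pdivlMl ?expR_gt0// mulr1.
have h4 : (expR c - 1) * (2^-1 + delta / 4) <= c * (2^-1 + delta / 2).
  have h5 : (expR c - 1) * (1 - c) <= c by lra.
  have hd : 2^-1 + delta / 4 <= (1 - c) * (2^-1 + delta / 2) by rewrite /c; nra.
  have e1 : 0 <= expR c - 1 by rewrite subr_ge0 -expR0 ler_expR ltW.
  apply: (@le_trans _ _ ((expR c - 1) * ((1 - c) * (2^-1 + delta / 2)))).
    by rewrite ler_wpM2l.
  by rewrite mulrA ler_wpM2r//; lra.
have h5 : c * delta = delta ^+ 2 / 4 by rewrite /c expr2 mulrAC.
lra.
Qed.

Lemma lower_tail_constants (R : realType) (delta : R) :
  0 < delta -> delta <= 4^-1 ->
  exists c kappa : R, [/\ 0 <= c, 0 < kappa &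
    c * (2^-1 - delta) - (1 - expR (- c)) * (2^-1 - delta / 2) <= - kappa].
Proof.
move=> d0 d1; pose c := delta / 2; have c0 : 0 < c by rewrite /c; lra.
exists c, (delta ^+ 2 / 16); split; [exact: ltW| by rewrite divr_gt0 ?exprn_gt0|].
have h : expR (- c) * (1 + c) <= 1.
  by rewrite expRN mulrC ler_pdivrMr ?expR_gt0// mul1r expR_ge1Dx.
have h1 : c / (1 + c) <= 1 - expR (- c).
  by rewrite ler_pdivrMr ?addr_gt0//; lra.
have h2 : c / (1 + c) * (2^-1 - delta / 2) <= (1 - expR (- c)) * (2^-1 - delta / 2).
  by rewrite ler_wpM2r//; lra.
have h3 : c * (2^-1 - delta) + delta ^+ 2 / 16 <= c / (1 + c) * (2^-1 - delta / 2).
  by rewrite [leRHS]mulrAC ler_pdivlMr ?addr_gt0// /c; nra.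
lra.
Qed.

Lemma random_family_concentration (R : realType) (delta : R) :
  0 < delta -> delta <= 4^-1 ->
  exists gam kappa : R, [/\ 0 < gam, 0 < kappa &
    forall (n t : nat) (p d : R), 0 <= p <= 1 -> (0 < t)%N ->
    (forall S : {set {set 'I_n}}, (2^-1 + delta / 4) * 2 ^+ n < #|S|%:R ->
      exists2 A, A \in S & d <= #|[set B in S | [disjoint A & B]]|%:R) ->
    1 <= gam * p * d ->
    t%:R * 'C(n, n./2)%:R <= delta * 2 ^+ n ->
    1 - 2 * expR (- (kappa * (2 ^+ n * p))) <=
    random_family_prob p (fun F : {set {set 'I_n}} =>
       ((2^-1 - delta) * 2 ^+ n * p <= (max_t_intersecting t F)%:R)
       && ((max_t_intersecting t F)%:R <= (2^-1 + delta) * 2 ^+ n * p))].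
Proof.
move=> d0 d1.
have [c [L [gam [k1 [c0 L0 gam0 k10 up]]]]] := upper_tail_constants d0 d1.
have [b [k2 [b0 k20 low]]] := lower_tail_constants d0 d1.
exists gam, (Num.min k1 k2); split=> //; first by rewrite lt_min k10.
move=> n t p d p01 t0 sat gpd tC; have /andP[p0 p1] := p01.
set mu := 2 ^+ n * p; have mu0 : 0 <= mu by rewrite mulr_ge0// exprn_ge0.
pose U := [set A : {set 'I_n} | (n + t <= #|A|.*2)%N].
have cardU : (2^-1 - delta / 2) * 2 ^+ n <= #|U|%:R.
  have := card_upper_layers n t; rewrite -(ler_nat R) natrD !natrM natrX -/U.
  lra.
pose E1 (F : {set {set 'I_n}}) := #|F :&: U|%:R < (2^-1 - delta) * 2 ^+ n * p.
pose E2 (F : {set {set 'I_n}}) :=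
  (2^-1 + delta) * 2 ^+ n * p < (max_t_intersecting t F)%:R.
have P1 : random_family_prob p E1 <= expR (- (Num.min k1 k2 * mu)).
  apply: le_trans (random_family_lower_tail _ _ p01 b0) _.
  rewrite ler_expR; have eb : 0 <= 1 - expR (- b).
    by rewrite subr_ge0 -[leRHS]expR0 ler_expR oppr_le0.
  have hU : p * (1 - expR (- b)) * ((2^-1 - delta / 2) * 2 ^+ n)
      <= p * (1 - expR (- b)) * #|U|%:R by rewrite ler_wpM2l// mulr_ge0.
  have hk : mu * (b * (2^-1 - delta) - (1 - expR (- b)) * (2^-1 - delta / 2)) <= mu * - k2.
    by rewrite ler_wpM2l.
  have hm : mu * Num.min k1 k2 <= mu * k2 by rewrite ler_wpM2l// ge_min lexx orbT.
  by rewrite /mu in hk hm *; lra.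
have P2 : random_family_prob p E2 <= expR (- (Num.min k1 k2 * mu)).
  apply: le_trans (random_family_upper_tail _ p01 t0 c0 L0 (ltW gam0) sat gpd) _.
  rewrite ler_expR -/mu.
  have hk := ler_wpM2l mu0 up.
  have hm : mu * Num.min k1 k2 <= mu * k1 by rewrite ler_wpM2l// ge_min lexx.
  lra.
apply: le_trans (random_family_prob_ge (E1 := E1) (E2 := E2) p01 _); first lra.
(* Outside both bad events, [F :&: U] is itself a t-intersecting subfamily that witnesses the lower
   bound. *)
move=> F; have [e1|e1] := boolP (E1 F); first by rewrite orbT.
have [e2|e2] := boolP (E2 F); first by rewrite !orbT.
move: e1 e2; rewrite /E1 /E2 -!leNgt !orbF => e1 ->; rewrite andbT.
apply: le_trans e1 _; rewrite ler_nat.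
apply: (leq_bigmax_cond (F := fun G : {set {set 'I_n}} => #|G|)).
rewrite subsetIl; apply/forall_inP => A; rewrite !inE => /andP[_ hA].
apply/forall_inP => B; rewrite !inE => /andP[_ hB].
exact: upper_layers_t_intersecting.
Qed.

(** * Choice of the window and of the gap *)

Lemma bin_le_pow2 (m n s : nat) : (m <= n)%N -> ('C(m, s) <= 2 ^ n)%N.
Proof.
move=> lemn; apply: (@leq_trans (2 ^ m)); last by rewrite leq_exp2l.
have := card_draws 'I_m s; rewrite card_ord => <-.
by rewrite -card_set_ord max_card.
Qed.

(** Here [q] is the integer part of sqrt n. The half-width [w] exceeds M sqrt n, so Chebyshev leaves
    few sets outside the window; [s] is of order sqrt n, with a constant so small that (2w+s)s <=
    eps (n/2 - w), which keeps the degrees within a factor 1 - eps. *)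
Lemma supersaturation_window (R : realFieldType) (n q M : nat) (eps : R) :
  let w := (M * q.+1)%N in let s := (q %/ (20 * M ^ 2))%N in
  let D := 'C(n./2 + w + s, s) in
  0 < eps -> eps <= 2^-1 -> eps^-1 <= M%:R ->
  (q ^ 2 <= n)%N -> (n < q.+1 ^ 2)%N -> (20 * M + 20 <= q)%N ->
  (q.+1 ^ s <= D)%N /\ (D <= 2 ^ n)%N /\
  forall S : {set {set 'I_n}}, (2^-1 + eps) * 2 ^+ n < #|S|%:R ->
    exists2 A, A \in S & eps / 4 * D%:R <= #|[set B in S | [disjoint A & B]]|%:R.
Proof.
move=> w s D e0 e1 eM qn nq lq.
have M0 : (0 < M)%N by rewrite -(ltr_nat R); apply: lt_le_trans eM; rewrite invr_gt0.
have sq : (20 * M ^ 2 * s <= q)%N by rewrite mulnC leq_trunc_div.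
have sM : (20 * M * s <= q)%N by nia.
have wq : (w <= 2 * M * q)%N by rewrite /w; nia.
have Mq : (20 * (M * q) + 20 * q <= q ^ 2)%N by nia.
have half : (q ^ 2 <= 2 * n./2 + 1)%N by lia.
have s1 : (20 * s <= q)%N by nia.
have q1 : (1 <= q)%N by lia.
have sw : (s + w <= n./2)%N by nia.
split; [|split].
- rewrite /D; have [->|s0] := posnP s; first by rewrite bin0.
  rewrite -(@leq_pmul2r (s ^ s)) ?expn_gt0 ?s0// -expnMn.
  apply: leq_trans (bin_lower_bound _ _); rewrite leq_exp2r// addnK.
  by nia.
- by apply: bin_le_pow2; lia.
move=> S largeS; apply: supersaturation => //.
- have := card_not_middle n w; set k := #|_| => hk.
  have hk2 : (4 * M ^ 2 * k <= 2 ^ n)%N.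
    have h : (q.+1 ^ 2 * (4 * M ^ 2 * k) <= q.+1 ^ 2 * 2 ^ n)%N.
      have -> : (q.+1 ^ 2 * (4 * M ^ 2 * k) = 4 * w ^ 2 * k)%N by rewrite /w; ring.
      by apply: leq_trans hk _; rewrite leq_mul2r ltnW ?orbT.
    by rewrite -(@leq_pmul2l (q.+1 ^ 2)).
  have eM1 : 1 <= eps * M%:R by rewrite -ler_pdivrMl// mulr1.
  rewrite -(ler_nat R) !natrM !natrX in hk2.
  have k0 : 0 <= k%:R :> R by [].
  have M1 : 1 <= M%:R :> R by rewrite ler1n.
  have h : 1 <= eps * M%:R ^+ 2 by nra.
  have := ler_wpM2l (ltW e0) hk2; have := ler_wpM2r k0 h; lra.
- have hb := bin_shift_bound (n./2 - w) (w + w + s) s.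
  have Eb : (n./2 - w + (w + w + s) = n./2 + w + s)%N by lia.
  rewrite Eb -/D -(ler_nat R) natrD !natrM in hb.
  have small : ((w + w + s) * s)%:R <= eps * (n./2 - w)%:R.
    have h1 : (20 * M ^ 2 * s * q <= q * q)%N by rewrite leq_mul2r sq orbT.
    have h2 : (20 * M * s * (20 * s) <= q * q)%N by rewrite leq_mul.
    have h3 : (M * s * w <= M * s * (2 * M * q))%N by rewrite leq_mul2l wq orbT.
    have h : (M * ((w + w + s) * s) <= n./2 - w)%N by nia.
    rewrite -(ler_nat R) natrM in h.
    apply: le_trans (ler_wpM2l (ltW e0) h).
    by rewrite mulrA ler_peMl// -ler_pdivrMl// mulr1.
  have m0 : 0 < (n./2 - w)%:R :> R by rewrite ltr0n; nia.
  rewrite -(ler_pM2l m0).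
  have D0 : 0 <= D%:R :> R by [].
  have := ler_wpM2r D0 small; rewrite natrM; lra.
Qed.

Lemma random_family_prob_mono (R : realType) (n : nat) (p : R)
    (E1 E2 : pred {set {set 'I_n}}) :
  0 <= p <= 1 -> subpred E1 E2 -> random_family_prob p E1 <= random_family_prob p E2.
Proof.
move=> p01 sub; rewrite /random_family_prob [leRHS]big_mkcond [leLHS]big_mkcond /=.
apply: ler_sum => F _; have := random_family_mass_ge0 F p01; have := sub F.
by case: (E1 F) => [/(_ isT) ->//|_]; case: (E2 F).
Qed.

Lemma sqrt_bin_mid_bound (R : rcfType) (n : nat) :
  Num.sqrt n%:R * 'C(n, n./2)%:R <= 2 ^+ n :> R.
Proof.
rewrite -ler_sqr ?nnegrE ?mulr_ge0 ?sqrtr_ge0 ?exprn_ge0//.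
rewrite exprMn sqr_sqrtr// -exprM mulnC exprM.
have := bin_mid_bound n; rewrite -(ler_nat R) natrM !natrX -natr1 => h.
have c0 : 0 <= 'C(n, n./2)%:R ^+ 2 :> R by exact: sqr_ge0.
have -> : 2 ^+ 2 = 4%:R :> R by ring.
by lra.
Qed.

Local Open Scope classical_set_scope.
Local Open Scope ring_scope.

(** * Asymptotics in [n] *)

Lemma near_sqrt_ge (R : realType) (x : R) :
  \forall n \near \oo, x <= Num.sqrt (n%:R : R).
Proof.
near=> n; apply: (@le_trans _ _ (Num.sqrt (x ^+ 2))).
  by rewrite sqrtr_sqr ler_norm.
rewrite ler_sqrt//; near: n; exact: nbhs_infty_ger.
Unshelve. all: by end_near. Qed.

(** [D] is at least exp(r ln n / (4K)), and the bound on [f] lets the edge probability cancel at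
    most half of that exponent; exp(x) >= x does the rest. *)
Lemma window_growth (R : realType) (n q K D : nat) (f : R) :
  let r : R := Num.sqrt n%:R in
  (0 < K)%N -> q%:R <= r < q.+1%:R -> (2 * K)%:R <= r -> expR 1 <= n%:R :> R ->
  (q.+1 ^ (q %/ K) <= D)%N ->
  `|f| <= (8 * K)%:R^-1 * `|r * log2 (n%:R : R)| ->
  r / (8 * K)%:R <= 2 `^ (- f) * D%:R :> R.
Proof.
move=> r K0 /andP[qr rq] Kr en qD fb.
set s := (q %/ K)%N in qD.
have KR : 0 < K%:R :> R by rewrite ltr0n.
have r0 : 0 < r by apply: lt_le_trans Kr; rewrite ltr0n; lia.
have n0 : 0 < n%:R :> R by apply: lt_le_trans en; exact: expR_gt0.
have ln1 : 1 <= ln n%:R :> R by rewrite -[leLHS]expRK ler_ln ?posrE ?expR_gt0.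
have ln20 : 0 < ln 2 :> R by rewrite ln_gt0// ltr1n.
have lnr : ln n%:R = 2 * ln r.
  have -> : n%:R = r ^+ 2 by rewrite sqr_sqrtr.
  by rewrite lnXn// mulr_natl.
(* Rounding gives s + 1 > r/K, and r >= 2K absorbs the lost unit. *)
have sr : r / (2 * K)%:R <= s%:R.
  have h : (q.+1 <= K * s.+1)%N by rewrite mulnC ltn_ceil.
  rewrite -(ler_nat R) natrM -natr1 in h.
  rewrite ler_pdivrMr ?ltr0n ?muln_gt0// natrM; rewrite natrM in Kr.
  have := natr1 s; lra.
have Dlow : expR (r * ln n%:R / (4 * K)%:R) <= D%:R.
  apply: (@le_trans _ _ (q.+1%:R ^+ s)); last by rewrite -natrX ler_nat.
  apply: (@le_trans _ _ (r ^+ s)); last by rewrite lerXn2r ?nnegrE ?ltW.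
  rewrite -[X in _ <= X ^+ _]lnK ?posrE// -expRM_natl ler_expR lnr.
  have -> : r * (2 * ln r) / (4 * K)%:R = r / (2 * K)%:R * ln r.
    by rewrite !natrM; field; rewrite lt0r_neq0.
  by rewrite ler_wpM2r//; lra.
have plow : expR (- (r * ln n%:R / (8 * K)%:R)) <= 2 `^ (- f).
  rewrite /powR gt_eqF// ler_expR mulNr lerN2.
  apply: (@le_trans _ _ (`|f| * ln 2)); first by rewrite ler_wpM2r ?ler_norm// ltW.
  rewrite -ler_pdivlMr//; apply: le_trans fb _.
  have l0 : 0 <= r * log2 n%:R by rewrite mulr_ge0 ?divr_ge0 ?ltW//; lra.
  rewrite ger0_norm// /log2 le_eqVlt; apply/orP; left; apply/eqP; ring.
apply: le_trans (ler_pM _ _ plow Dlow); rewrite ?expR_ge0// -expRD.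
apply: le_trans (le_trans _ (expR_ge1Dx _)) (lexx _).
have -> : - (r * ln n%:R / (8 * K)%:R) + r * ln n%:R / (4 * K)%:R = r / (8 * K)%:R * ln n%:R.
  by rewrite !natrM; field; rewrite lt0r_neq0.
have x0 : 0 <= r / (8 * K)%:R by rewrite divr_ge0// ltW.
have := ler_peMr x0 ln1; lra.
Qed.

Theorem theorem6p4 (R : realType) (p : nat -> R) (t : nat -> nat)
    (hp01 : forall n : nat, 0 <= p n <= 1)
    (hp : exists2 f : nat -> R,
        f =o_\oo (fun n : nat => Num.sqrt (n%:R : R) * log2 (n%:R : R)) &
        \forall n \near \oo, p n = 2 `^ (- f n))
    (ht0 : forall n : nat, (0 < t n)%N)
    (ht : (fun n : nat => (t n)%:R : R) =o_\oo
          (fun n : nat => Num.sqrt (n%:R : R)))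
    (delta : R) (hdelta : 0 < delta) :
  (fun n : nat =>
     random_family_prob (p n) (fun F : {set {set 'I_n}} =>
       ((2^-1 - delta) * 2 ^+ n * p n <= (max_t_intersecting (t n) F)%:R)
       && ((max_t_intersecting (t n) F)%:R <= (2^-1 + delta) * 2 ^+ n * p n)))
    @ \oo --> (1 : R).
Proof.
(* The claim for a smaller [delta] is stronger, so [delta] may be capped at 1/4, as the choice of
   constants requires. *)
pose dl := Num.min delta 4^-1; pose eps := dl / 4.
have dl0 : 0 < dl by rewrite lt_min hdelta invr_gt0 ltr0n.
have dl4 : dl <= 4^-1 by rewrite ge_min lexx orbT.
have dld : dl <= delta by rewrite ge_min lexx.
have eps0 : 0 < eps by rewrite divr_gt0.
have eps1 : eps <= 2^-1 by rewrite /eps; lra.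
have [gam [kappa [gam0 kappa0 conc]]] := random_family_concentration dl0 dl4.
have [f fo pf] := hp.
pose M := (Num.truncn (eps^-1)).+1; pose K := (20 * M ^ 2)%N.
have K0 : (0 < K)%N by [].
have eM : eps^-1 <= M%:R by rewrite ltW// truncnS_gt.
have K80 : 0 < (8 * K)%:R :> R by rewrite ltr0n.
move/eqoP: fo => /(_ (8 * K)%:R^-1); rewrite invr_gt0 => /(_ K80) fo.
move/eqoP: ht => /(_ dl dl0) ht.
apply/cvgrPdist_le => e e0; near=> n.
have /andP[p0 p1] := hp01 n.
set r := Num.sqrt (n%:R : R).
pose q := Num.truncn r.
have qr : q%:R <= r < q.+1%:R by rewrite truncn_itv ?sqrtr_ge0.
have [qr1 qr2] := andP qr.
have rn : r ^+ 2 = n%:R by rewrite sqr_sqrtr.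
have r0 : 0 <= r by exact: sqrtr_ge0.
have qn : (q ^ 2 <= n)%N.
  by rewrite -(ler_nat R) natrX -rn lerXn2r ?nnegrE.
have nq : (n < q.+1 ^ 2)%N.
  by rewrite -(ltr_nat R) natrX -rn ltrXn2r ?nnegrE.
have lq : (20 * M + 20 <= q)%N.
  rewrite -ltnS -(ltr_nat R); apply: le_lt_trans qr2.
  by rewrite /r; near: n; exact: near_sqrt_ge.
have [Dlow [Dup sat]] := @supersaturation_window R n q M eps eps0 eps1 eM qn nq lq.
set D := 'C(_, _) in Dlow Dup sat.
have pD : r / (8 * K)%:R <= p n * D%:R.
  have -> : p n = 2 `^ (- f n) by near: n.
  apply: (@window_growth R n q K D) => //.
  - by rewrite /r; near: n; exact: near_sqrt_ge.
  - by near: n; exact: nbhs_infty_ger.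
  - by near: n.
(* Since [D] is at most 2^n, the same growth shows that the mean size of the random family tends to
   infinity. *)
have mu : r / (8 * K)%:R <= 2 ^+ n * p n.
  apply: le_trans pD _; rewrite mulrC ler_wpM2r// -natrX ler_nat.
  exact: Dup.
have gpD : 1 <= gam * p n * (eps / 4 * D%:R).
  have h : 1 <= gam * (eps / 4) * (r / (8 * K)%:R).
    rewrite -ler_pdivrMl ?mulr_gt0 ?divr_gt0// ler_pdivlMr//.
    by rewrite /r; near: n; exact: near_sqrt_ge.
  apply: le_trans h _.
  rewrite [leRHS](_ : _ = gam * (eps / 4) * (p n * D%:R)); last by ring.
  by rewrite ler_wpM2l// ltW// mulr_gt0 ?divr_gt0.
(* Eventually t <= dl sqrt n, while a layer has at most 2^n / sqrt n sets. *)
have tC : (t n)%:R * 'C(n, n./2)%:R <= dl * 2 ^+ n :> R.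
  apply: (@le_trans _ _ (dl * r * 'C(n, n./2)%:R)).
    rewrite ler_wpM2r//.
    have : `|(t n)%:R| <= dl * `|r| by rewrite /r; near: n.
    by rewrite ger0_norm// (ger0_norm r0).
  by rewrite -mulrA ler_wpM2l ?(ltW dl0)//; exact: sqrt_bin_mid_bound.
have := conc n (t n) (p n) _ (hp01 n) (ht0 n) sat gpD tC.
set P1 := random_family_prob _ _; set P2 := random_family_prob _ _.
have P12 : P1 <= P2.
  apply: random_family_prob_mono => // F /andP[lo hi].
  have mu0 : 0 <= 2 ^+ n * p n by rewrite mulr_ge0// exprn_ge0.
  have := ler_wpM2r mu0 dld.
  by move: lo hi; rewrite -!mulrA => lo hi hd; apply/andP; split; lra.
have P2le : P2 <= 1 by exact: random_family_prob_le1.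
move=> low; rewrite ger0_norm ?subr_ge0//.
suff : 2 * expR (- (kappa * (2 ^+ n * p n))) <= e by lra.
have : 2 / e <= kappa * (2 ^+ n * p n).
  apply: le_trans (ler_wpM2l (ltW kappa0) mu).
  rewrite -ler_pdivrMl// ler_pdivlMr//.
  by rewrite /r; near: n; exact: near_sqrt_ge.
set x := kappa * _ => xe; rewrite expRN ler_pdivrMr ?expR_gt0//.
rewrite mulrC -ler_pdivrMr//; apply: le_trans xe _.
by have := expR_ge1Dx x; lra.
Unshelve. all: by end_near. Qed.
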